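(* For all $T>0$, for all $S>0$, for any $\gamma>0$, for all $m\in\mathbb{N}$, for all $\Delta s>0$ (of the form $\Delta s=S/n$), and for any positive $\Delta t<2$ satisfying $$g\left(\Delta t,\tfrac{2}{\Delta s},\gamma\right)>0,$$ the matrix $(\boldsymbol{O}\boldsymbol{C}\boldsymbol{O})^m$ is asymptotically stable (all its eigenvalues have modulus strictly less than $1$).
   Context: Let $S>0$, let $n\ge2$ be an integer and let $\Delta s = S/n$ (spatial step size); $\Delta t>0$ is the time step size and $\gamma$ a friction parameter. $\boldsymbol{L}$ is the $(n-1)\times(n-1)$ discrete Dirichlet Laplacian: the symmetric tridiagonal matrix with diagonal entries $-2/\Delta s^2$ and entries $1/\Delta s^2$ on the first sub- and superdiagonal. With $\boldsymbol{I}$ the identity matrix, define the $2(n-1)\times2(n-1)$ matrices $$\boldsymbol{A} = \begin{bmatrix} \boldsymbol{0} & \boldsymbol{I}\\ \boldsymbol{L} & \boldsymbol{0}\end{bmatrix},\quad \boldsymbol{B}=\begin{bmatrix}\boldsymbol{0}&\boldsymbol{0}\\-\boldsymbol{I}&\boldsymbol{0}\end{bmatrix},\quad \boldsymbol{C} = \exp\left(\tfrac12 \Delta t\, \boldsymbol{B}\right)\mathrm{cay}(\Delta t\, \boldsymbol{A})\exp\left(\tfrac12 \Delta t\, \boldsymbol{B}\right),\quad \boldsymbol{O}=\begin{bmatrix}\boldsymbol{I}&\boldsymbol{0}\\ \boldsymbol{0}& e^{-\gamma\Delta t/2}\boldsymbol{I}\end{bmatrix},$$ where $\mathrm{cay}(\boldsymbol{X})=(\boldsymbol{I}-\frac12\boldsymbol{X})^{-1}(\boldsymbol{I}+\frac12\boldsymbol{X})$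 is the Cayley transform and $\exp$ the matrix exponential. For $0<\Delta t<2$, $\omega>0$ and $\gamma\ge0$, $$g(\Delta t,\omega,\gamma)=1-\cos^2(\theta)\cosh^2\left(\frac{\gamma\Delta t}{2}\right),\qquad \theta=2\arctan\left(\frac{\Delta t}{\sqrt{4-\Delta t^2}}\sqrt{1+\omega^2}\right).$$ *)

(* Defs.v *)
From mathcomp Require Import all_boot all_order all_algebra.
From mathcomp Require Import all_classical all_reals all_analysis.
From mathcomp Require Import complex.

Set Implicit Arguments.
Unset Strict Implicit.
Unset Printing Implicit Defensive.

Import Order.TTheory GRing.Theory Num.Theory.
Import numFieldNormedType.Exports.

Local Open Scope ring_scope.

Definition cosh (R : realType) (x : R) : R := (expR x + expR (- x)) / 2.

Definition mxexp (R : realType) (k : nat) (X : 'M[R]_k) : 'M[R]_k :=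
  limn (series (fun j : nat => (j`!%:R)^-1 *: X ^+ j)).

(* invmx is the true inverse only on unitmx and the identity function
   elsewhere; 1 - X / 2 is invertible for every X = dt *: Amx d ds. *)
Definition cay (R : realType) (k : nat) (X : 'M[R]_k) : 'M[R]_k :=
  invmx (1%:M - 2^-1 *: X) *m (1%:M + 2^-1 *: X).

(* In the definitions below d stands for n - 1, the number of interior grid
   points. *)
Definition Lmx (R : realType) (d : nat) (ds : R) : 'M[R]_d :=
  \matrix_(i, j)
    if i == j then - (2 / ds ^+ 2)
    else if (i.+1 == j :> nat) || (j.+1 == i :> nat) then 1 / ds ^+ 2
    else 0.

Definition Amx (R : realType) (d : nat) (ds : R) : 'M[R]_(d + d) :=
  block_mx 0 1%:M (Lmx d ds) 0.

Definition Bmx (R : realType) (d : nat) : 'M[R]_(d + d) :=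
  block_mx 0 0 (- 1%:M) 0.

Definition Cmx (R : realType) (d : nat) (ds dt : R) : 'M[R]_(d + d) :=
  mxexp ((2^-1 * dt) *: Bmx R d) *m cay (dt *: Amx d ds)
    *m mxexp ((2^-1 * dt) *: Bmx R d).

Definition Omx (R : realType) (d : nat) (gamma dt : R) : 'M[R]_(d + d) :=
  block_mx 1%:M 0 0 (expR (- (gamma * dt / 2)))%:M.

Definition theta (R : realType) (dt omega : R) : R :=
  2 * atan (dt / Num.sqrt (4 - dt ^+ 2) * Num.sqrt (1 + omega ^+ 2)).

Definition g (R : realType) (dt omega gamma : R) : R :=
  1 - cos (theta dt omega) ^+ 2 * cosh (gamma * dt / 2) ^+ 2.

(* eigenvalue is relative to the coefficient field, hence the embedding of the
   real matrix into the complex ones; the order of R[i] is partial, and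
   `|z| < 1 there says that the modulus, a real number, is less than 1. *)
Definition asymptotically_stable (R : realType) (k : nat) (M : 'M[R]_k) : Prop :=
  forall z : R[i], eigenvalue (map_mx (real_complex R) M) z -> `|z| < 1.

(* Main.v *)
Require Import Defs.
From mathcomp Require Import all_boot all_order all_algebra.
From mathcomp Require Import all_classical all_reals all_analysis.
From mathcomp Require Import complex.
From mathcomp Require Import zify ring lra.

Set Implicit Arguments.
Unset Strict Implicit.
Unset Printing Implicit Defensive.

Import Order.TTheory GRing.Theory Num.Theory.
Import numFieldNormedType.Exports.

Local Open Scope ring_scope.

(** Eigenvalues of a power are powers of eigenvalues ([eigenvalue_exp]), so it
    suffices to show that every eigenvalue [z] of [O C O] has modulus below 1.

    Put [h = dt / 2], [e = exp (- gamma dt / 2)], [f = e ^ 2] and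
    [E = exp ((dt / 2) B)], which is [1 + (dt / 2) B] because [B ^ 2 = 0].  If
    all the blocks were scalars, with [L = - omega ^ 2], then [O C O] would
    have determinant [f] and trace [(1 + f) c], where
      [c = (1 - 2 h ^ 2 - h ^ 2 omega ^ 2) / (1 + h ^ 2 omega ^ 2)]
    is the [cos theta] of the frequency [omega].  Since [h < 1] one has
    [-1 < c < 1], and then both roots of [z ^ 2 - (1 + f) c z + f] lie in the
    open unit disc because [0 < f < 1] ([quadratic_root_lt1]).

    The general case reduces to this one without diagonalizing [L].  Let [v] be
    a row eigenvector for [z], let [K] be the Cayley factor, and set
    [q = v O E K].  Clearing the inverse in [K] gives
      [z q (1 - h A) = q (E O O E) (1 + h A)],
    a linear system in the two halves [a] and [b] of [q] in which the only
    matrix left is [L].  Pairing it with [b] and eliminating the component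
    along [a] leaves the scalar quadratic above, where [omega ^ 2] is now the
    Rayleigh quotient [- <b L, b> / <b, b>] ([reduced_eigenvalue_lt1]).  All
    that is needed of [L] is that this quotient is real and nonnegative, and
    this follows from [L = - D D^T / ds ^ 2] with [D] the difference matrix
    ([Lmx_neg_semidef]).  The same fact makes [1 - h A] invertible. *)

(** * Eigenvalues of powers *)

(** Apply the factors to [v] one by one: the last nonzero vector obtained is an
    eigenvector for the next factor's root. *)
Lemma eigenvalue_prod_sub (F : fieldType) (k : nat) (A : 'M[F]_k) (s : seq F)
    (v : 'rV[F]_k) :
  v != 0 -> v *m (\prod_(w <- s) (A - w%:M)) = 0 ->
  exists2 w, w \in s & eigenvalue A w.
Proof.
elim: s v => [|w s IHs] v v_neq0.
  by rewrite big_nil mulmx1 => v0; rewrite v0 eqxx in v_neq0.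
rewrite big_cons -mulmxE mulmxA.
have [vAw _ | vAw] := eqVneq (v *m (A - w%:M)) 0.
  exists w; rewrite ?mem_head //; apply/eigenvalueP; exists v => //.
  by apply/eqP; rewrite -subr_eq0 -mul_mx_scalar -mulmxBr vAw.
by case/(IHs _ vAw) => w' w's Aw'; exists w' => //; rewrite inE w's orbT.
Qed.

(** Over a closed field ['X^m - z] splits, so [A ^+ m - z] is a product of
    factors [A - w] with [w ^+ m = z]. *)
Lemma eigenvalue_exp (F : closedFieldType) (k : nat) (A : 'M[F]_k) (m : nat)
    (z : F) :
  (0 < m)%N -> eigenvalue (A ^+ m) z -> exists2 w, eigenvalue A w & w ^+ m = z.
Proof.
move=> m_gt0; case: k A => [|k] A /eigenvalueP[v vA v_neq0].
  by rewrite [v]thinmx0 eqxx in v_neq0.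
pose p : {poly F} := 'X^m - z%:P.
have [s ps] := closed_field_poly_normal p.
have Ap : horner_mx A p = \prod_(w <- s) (A - w%:M).
  rewrite ps (monicP (monicXnsubC z m_gt0)) scale1r rmorph_prod /=.
  by apply: eq_bigr => w _; rewrite rmorphB /= horner_mx_X horner_mx_C.
have [|w ws Aw] := @eigenvalue_prod_sub _ _ A s v v_neq0.
  rewrite -Ap rmorphB /= rmorphXn /= horner_mx_X horner_mx_C.
  by rewrite mulmxBr vA mul_mx_scalar subrr.
exists w => //; apply/eqP; rewrite -subr_eq0.
have : root p w.
  by rewrite ps (monicP (monicXnsubC z m_gt0)) scale1r root_prod_XsubC.
by rewrite /root !hornerE.
Qed.

(** * A root location criterion *)

(** This is the Schur-Cohn criterion for a real quadratic.  A nonreal root has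
    its conjugate as the other root, so its squared modulus is the product [q]
    of the roots.  The polynomial is positive at [1] and at [-1], which excludes
    a real root outside the disc since the product of the roots is below 1. *)
Lemma quadratic_root_lt1 (R : realType) (q b : R) (z : R[i]) :
  0 < q < 1 -> `|b| < 1 + q -> z ^+ 2 - b%:C%C * z + q%:C%C = 0 -> `|z| < 1.
Proof.
case/andP=> q_gt0 q_lt1; rewrite ltr_norml => /andP[b_gt b_lt].
case: z => x y; rewrite normc_def /=.
move=> /eqP; rewrite eq_complex /= => /andP[/eqP re0 /eqP im0].
suff lt1: x ^+ 2 + y ^+ 2 < 1.
  by rewrite -[1]/(1%:C%C) ltcR -sqrtr1 ltr_sqrt.
have [y0|y_neq0] := eqVneq y 0.
  have {}re0 : x ^+ 2 + q = b * x by move: re0; rewrite y0 => re0; lra.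
  rewrite y0 expr0n addr0 -(real_normK (num_real x)) -[1](expr1n _ 2) ltrXn2r //=.
  rewrite ltr_norml; apply/andP; split; rewrite ltNge; apply/negP => x_out; nra.
have xb : 2 * x = b by apply: (mulIf y_neq0); lra.
by nra.
Qed.

(** * Negativity of the discrete Laplacian *)

Local Open Scope sesquilinear_scope.

(** [u *m difference_mx] lists the jumps of [u] across the [d + 1] grid cells
    when [u] is extended by zero to the two boundary points, which is how the
    Dirichlet condition enters. *)
Definition difference_mx (F : pzRingType) (d : nat) : 'M[F]_(d, d.+1) :=
  \matrix_(i, k) ((k == i :> nat)%:R - (k == i.+1 :> nat)%:R).

(** This factorization is summation by parts for the second difference. *)
Lemma Lmx_factor (R : realType) (d : nat) (ds : R) :
  Lmx d ds = - ds ^- 2 *: (difference_mx R d *m (difference_mx R d)^T).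
Proof.
apply/matrixP=> i j; rewrite !mxE.
(* Summing against an indicator evaluates at the selected index. *)
have pick (a : 'I_d.+1) (f : 'I_d.+1 -> R) :
    \sum_(k < d.+1) (k == a :> nat)%:R * f k = f a.
  rewrite (bigD1 a) //= eqxx mul1r big1 ?addr0 // => k /negPf ka.
  by rewrite -[_ == _]/(k == a) ka mul0r.
under eq_bigr => k _ do rewrite !mxE mulrBl.
rewrite sumrB.
rewrite (pick (widen_ord (leqnSn d) i) (fun k : 'I_d.+1 => _ - _)).
rewrite (pick (lift ord0 i) (fun k : 'I_d.+1 => _ - _)) /=.
rewrite /bump /= add1n eqSS (eq_sym (i : nat) j.+1).
have [->|ij] := eqVneq i j.
  by rewrite eqxx !(gtn_eqF (ltnSn j)) /=; lra.
rewrite -val_eqE /= in ij; rewrite (negPf ij).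
have [ij1|_] := eqVneq i.+1 j; have [ji1|_] := eqVneq j.+1 i => /=; try lra.
by exfalso; lia.
Qed.

(** Nonpositivity in the partial order of [C] also asserts that the quadratic
    form takes real values. *)
Definition neg_semidef (C : numClosedFieldType) (d : nat) (L : 'M[C]_d) :=
  forall u : 'rV[C]_d, (u *m L *m u ^t*) 0 0 <= 0.

Lemma dot_ge0 (C : numClosedFieldType) (d : nat) (u : 'rV[C]_d) :
  0 <= (u *m u ^t*) 0 0.
Proof. by rewrite -dotmxE dnorm_ge0. Qed.

Lemma dot_gt0 (C : numClosedFieldType) (d : nat) (u : 'rV[C]_d) :
  u != 0 -> 0 < (u *m u ^t*) 0 0.
Proof. by rewrite -dotmxE; apply: dotmx_is_dotmx. Qed.

(** By the factorization, [<u L, u> = - |u D| ^ 2 / ds ^ 2]. *)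
Lemma Lmx_neg_semidef (R : realType) (d : nat) (ds : R) :
  neg_semidef (map_mx (real_complex R) (Lmx d ds)).
Proof.
move=> u; rewrite Lmx_factor map_mxZ map_mxM.
rewrite -[map_mx _ (difference_mx R d)^T]map_trmx.
set D := map_mx _ (difference_mx R d).
have Dt : D^T = D ^t*.
  by apply/matrixP => i j; rewrite !mxE conj_Creal // complex_real.
rewrite -scalemxAr -scalemxAl mxE (mulmxA u) Dt -(mulmxA _ _ (u ^t*)).
have -> : D ^t* *m u ^t* = (u *m D) ^t* by rewrite trmx_mul map_mxM.
rewrite mulr_le0_ge0 ?dot_ge0 // -[0]/(0%:C%C) lecR oppr_le0 invr_ge0.
exact: sqr_ge0.
Qed.

(** * The Cayley and exponential factors *)

(** The block matrix is [1 - h A].  A row vector [(a, b)] in its kernel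
    satisfies [b = h ^ 2 b L], so pairing with [b] makes [|b| ^ 2]
    nonpositive. *)
Lemma one_sub_hA_unit (R : realType) (d : nat) (h : R) (L : 'M[R[i]]_d) :
  neg_semidef L -> block_mx 1%:M (- h%:C%C)%:M (- h%:C%C *: L) 1%:M \in unitmx.
Proof.
move=> L_nsd; rewrite -row_free_unit -kermx_eq0; apply/rowV0P=> v /sub_kermxP.
rewrite -[v]hsubmxK; move: (lsubmx v) (rsubmx v) => a b.
rewrite mul_row_block -row_mx0 !mulmx1 !mul_mx_scalar -scalemxAr.
case/eq_row_mx => a_eq b_eq.
have {}a_eq : a = h%:C%C *: (b *m L).
  by apply/eqP; rewrite -subr_eq0 -a_eq scaleNr.
have {}b_eq : b = (h ^+ 2)%:C%C *: (b *m L).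
  rewrite rmorphXn expr2 -scalerA -a_eq; apply/eqP.
  by rewrite -subr_eq0 -b_eq scaleNr addrC.
suff b0 : b = 0 by rewrite a_eq b0 mul0mx scaler0 row_mx0.
apply/eqP; apply: contraT => /dot_gt0.
rewrite {1}b_eq -scalemxAl mxE => /lt_geF/negP[].
by rewrite mulr_ge0_le0 ?L_nsd // -[0]/(0%:C%C) lecR sqr_ge0.
Qed.

(** The two factors of the Cayley transform commute, so the inverse can also be
    cleared from the right. *)
Lemma cay_mul (R : realType) (k : nat) (X : 'M[R]_k) :
  1%:M - 2^-1 *: X \in unitmx ->
  cay X *m (1%:M - 2^-1 *: X) = 1%:M + 2^-1 *: X.
Proof.
move=> W_unit; rewrite /cay -mulmxA.
set W := 1%:M - _ in W_unit *; set V := 1%:M + _.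
suff -> : V *m W = W *m V by rewrite mulKmx.
(* Both are polynomials in [W]. *)
have -> : V = 1%:M + 1%:M - W by rewrite /V /W opprB addrACA subrr addr0.
clearbody W; rewrite mulmxBl mulmxBr mulmxDl mulmxDr.
by rewrite mul1mx mulmx1.
Qed.

(** The exponential series of a square-zero matrix stops after two terms, so its
    partial sums are eventually constant. *)
Lemma mxexp_sq0 (R : realType) (k : nat) (X : 'M[R]_k) :
  X *m X = 0 -> mxexp X = 1%:M + X.
Proof.
move=> X2; apply: norm_lim_near_cst; exists 2%N => // -[|[|N]] // _.
rewrite /series /= !big_nat_recl //= big1_seq ?addr0.
  by rewrite !expr0 expr1 !invr1 !scale1r.
by move=> j _; rewrite 2!exprS -mulmxE mulmxA X2 mul0mx scaler0.
Qed.

Lemma mxexp_Bmx (R : realType) (d : nat) (h : R) :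
  mxexp (h *: Bmx R d) = block_mx 1%:M 0 (- h)%:M 1%:M.
Proof.
rewrite mxexp_sq0 /Bmx.
  rewrite scalar_mx_block scale_block_mx add_block_mx !scaler0 !addr0 add0r.
  by rewrite scalerN scalemx1 raddfN.
rewrite -scalemxAl -scalemxAr mulmx_block !(mul0mx, mulmx0, addr0).
by rewrite block_mx_const !scaler0.
Qed.

Lemma cay_Amx (R : realType) (d : nat) (ds dt : R) (h := 2^-1 * dt)
    (L := Lmx d ds) :
  cay (dt *: Amx d ds) *m block_mx 1%:M (- h)%:M (- h *: L) 1%:M =
    block_mx 1%:M h%:M (h *: L) 1%:M.
Proof.
have XE : 2^-1 *: (dt *: Amx d ds) = block_mx 0 h%:M (h *: L) 0.
  by rewrite scalerA scale_block_mx !scaler0 scalemx1.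
have WE : 1%:M - 2^-1 *: (dt *: Amx d ds) =
    block_mx 1%:M (- h)%:M (- h *: L) 1%:M.
  rewrite XE scalar_mx_block opp_block_mx add_block_mx !(oppr0, addr0) !add0r.
  by rewrite scaleNr raddfN.
have VE : 1%:M + 2^-1 *: (dt *: Amx d ds) =
    block_mx 1%:M h%:M (h *: L) 1%:M.
  by rewrite XE scalar_mx_block add_block_mx !addr0 !add0r.
rewrite -WE -VE cay_mul // WE -(map_unitmx (real_complex R)) map_block_mx.
rewrite !(map_mx1, map_mxZ, map_scalar_mx) rmorphN.
exact: one_sub_hA_unit (@Lmx_neg_semidef R d ds).
Qed.

(** * The reduced eigenvalue problem *)

(** The two equations are the halves of [z q (1 - h A) = q (E O O E) (1 + h A)]
    for [q = (a, b)], the first one coming from the left block column. *)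
Lemma reduced_eigenvalue_lt1 (R : realType) (d : nat) (h f : R) (L : 'M[R[i]]_d)
    (z : R[i]) (a b : 'rV[R[i]]_d) :
  0 < h < 1 -> 0 < f < 1 -> neg_semidef L -> row_mx a b != 0 ->
  z *: (a - h%:C%C *: (b *m L)) =
    a - (h * (1 + f))%:C%C *: b + h%:C%C *: (f%:C%C *: (b *m L)) ->
  z *: (- (h%:C%C *: a) + b) =
    h%:C%C *: (a - (h * (1 + f))%:C%C *: b) + f%:C%C *: b ->
  `|z| < 1.
Proof.
move=> /andP[h_gt0 h_lt1] /andP[f_gt0 f_lt1] L_nsd ab_neq0 eq1 eq2.
have h_neq0 : h%:C%C != 0.
  by rewrite -[0]/(0%:C%C) (inj_eq (@complexI _)) gt_eqF.
(* If [b = 0], the equations read [z a = a] and [- z h a = h a]. *)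
have b_neq0 : b != 0.
  apply: contraNneq ab_neq0 => b0.
  move: eq1 eq2; rewrite b0 !(mul0mx, scaler0, subr0, add0r, sub0r, addr0).
  move=> za; rewrite scalerN !scalerA mulrC -scalerA za => /eqP.
  rewrite eq_sym -addr_eq0 -scalerDl scaler_eq0 -mulr2n mulrn_eq0.
  rewrite (negPf h_neq0) /=.
  by move/eqP->; rewrite row_mx0.
(* From here on everything is paired with [b]: [al], [N] and [La] are the
   pairings of [a], [b] and [b L]. *)
have N_gt0 := dot_gt0 b_neq0; have La_le0 := L_nsd b.
pose phi (u : 'rV[R[i]]_d) := (u *m b ^t*) 0 0.
have phiD u v : phi (u + v) = phi u + phi v by rewrite /phi mulmxDl mxE.
have phiZ c u : phi (c *: u) = c * phi u by rewrite /phi -scalemxAl mxE.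
have phiN u : phi (- u) = - phi u by rewrite /phi mulNmx mxE.
move/(congr1 phi): eq1; move/(congr1 phi): eq2; rewrite !(phiD, phiZ, phiN).
rewrite -/(phi b) in N_gt0; rewrite -/(phi (b *m L)) in La_le0.
move: (phi a) (phi b) (phi (b *m L)) N_gt0 La_le0 => al N La N_gt0 La_le0.
have [Nr N_eq] : exists Nr : R, N = Nr%:C%C.
  by exists (complex.Re N); rewrite RRe_real // gtr0_real.
have [Lr La_eq] : exists Lr : R, La = (- Lr)%:C%C.
  by exists (- complex.Re La); rewrite opprK RRe_real // ler0_real.
rewrite N_eq La_eq in N_gt0 La_le0 *.
rewrite -[0]/(0%:C%C) ltcR in N_gt0.
rewrite -[0]/(0%:C%C) lecR oppr_le0 in La_le0.
(* [P] and [c] are the [1 + h ^ 2 omega ^ 2] and [cos theta] of the scalar case,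
   with [omega ^ 2 = Lr / Nr], the former multiplied by [Nr]. *)
set P := Nr + h ^+ 2 * Lr.
have P_gt0 : 0 < P by rewrite ltr_wpDr // mulr_ge0 // sqr_ge0.
have P_neq0 : P%:C%C != 0.
  by rewrite -[0]/(0%:C%C) (inj_eq (@complexI _)) gt_eqF.
move=> eq2 eq1.
pose c := (Nr - 2 * h ^+ 2 * Nr - h ^+ 2 * Lr) / P.
have cP : c * P = Nr - 2 * h ^+ 2 * Nr - h ^+ 2 * Lr by rewrite divfK // gt_eqF.
apply: (@quadratic_root_lt1 _ f ((1 + f) * c)); first by rewrite f_gt0.
  have c_lt1 : `|c| < 1.
    have hN_gt0 : 0 < h ^+ 2 * Nr by rewrite mulr_gt0 ?exprn_gt0.
    have hL_ge0 : 0 <= h ^+ 2 * Lr by rewrite mulr_ge0 ?sqr_ge0.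
    have hN_lt : h ^+ 2 * Nr < Nr by rewrite gtr_pMl // exprn_ilt1 // ltW.
    rewrite ltr_norml.
    by apply/andP; split; rewrite -(ltr_pM2r P_gt0) cP /P; lra.
  by rewrite normrM gtr0_norm; nra.
apply: (mulfI P_neq0); rewrite mulr0.
have {}cP : c%:C%C * P%:C%C = (Nr - 2 * h ^+ 2 * Nr - h ^+ 2 * Lr)%:C%C.
  by rewrite -rmorphM /= cP.
rewrite [((1 + f) * c)%:C%C]rmorphM mulrDr mulrBr.
have -> : P%:C%C * ((1 + f)%:C%C * c%:C%C * z) =
    (1 + f)%:C%C * (c%:C%C * P%:C%C) * z by ring.
rewrite cP /P; move: eq1 eq2.
rewrite !(rmorphD, rmorphM, rmorphN, rmorphXn, rmorph1, rmorph_nat) /=.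
move: (h%:C%C) (f%:C%C) (Nr%:C%C) (Lr%:C%C) h_neq0 => h' f' N' L' _ eq1 eq2.
(* These multipliers cancel [al]: it enters [eq1] and [eq2] with coefficients
   [z - 1] and [- h (z + 1)]. *)
have /eqP := congr2 (fun x y => (z - 1) * x + h' * (z + 1) * y) eq2 eq1.
rewrite -subr_eq0 => /eqP <-.
by ring.
Qed.

(** * Stability *)

(** Passing from the eigenvector [v] to [q = v O E K] turns the eigenvalue
    equation into one that is linear in [L], to which the reduced problem
    applies. *)
Lemma OCO_stable (R : realType) (gamma : R) (d : nat) (ds dt : R) :
  0 < gamma -> 0 < dt < 2 ->
  asymptotically_stable (Omx d gamma dt *m Cmx d ds dt *m Omx d gamma dt).
Proof.
move=> gamma_gt0 /andP[dt_gt0 dt_lt2] z /eigenvalueP[v].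
rewrite /Cmx mxexp_Bmx /Omx.
set h := 2^-1 * dt; set e := expR _; set L := Lmx d ds.
have h01 : 0 < h < 1 by rewrite /h; apply/andP; split; lra.
have f01 : 0 < e ^+ 2 < 1.
  rewrite exprn_gt0 ?expR_gt0 //= exprn_ilt1 ?expR_ge0 //.
  by rewrite expR_lt1 oppr_lt0 divr_gt0 // mulr_gt0.
set f := e ^+ 2 in f01.
set O := block_mx 1%:M 0 0 _; set E := block_mx 1%:M 0 _ 1%:M.
set K := cay _; set V := block_mx 1%:M h%:M (h *: L) 1%:M.
set W := block_mx 1%:M (- h)%:M (- h *: L) 1%:M.
pose phi := real_complex R.
have KW : K *m W = V := cay_Amx d ds dt.
have GE : E *m O *m (O *m E) = block_mx 1%:M 0 (- (h * (1 + f)))%:M f%:M.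
  rewrite /E /O !mulmx_block !(mul0mx, mulmx0, mul1mx, mulmx1, addr0, add0r).
  rewrite -!scalar_mxM -raddfD -expr2 -/f; congr (block_mx _ _ _%:M _).
  by rewrite /f; ring.
move=> vM v_neq0.
(* For [z = 0] the bound is immediate; otherwise [q = 0] would force [z v = 0],
   hence [v = 0]. *)
have [->|z_neq0] := eqVneq z 0; first by rewrite normr0.
pose p := v *m map_mx phi (O *m E).
pose q := p *m map_mx phi K.
have qG : q *m map_mx phi (E *m O *m (O *m E)) = z *: p.
  rewrite /q /p [RHS]scalemxAl -vM -!(mulmxA v) -!map_mxM.
  by rewrite !mulmxA.
have q_neq0 : q != 0.
  apply: contraNneq v_neq0 => q0; move: vM.
  have -> : O *m (E *m K *m E) *m O = O *m E *m K *m (E *m O) by rewrite !mulmxA.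
  rewrite map_mxM mulmxA (map_mxM _ (O *m E)) mulmxA -/p -/q q0 mul0mx.
  by move/esym/eqP; rewrite scaler_eq0 (negPf z_neq0).
(* Multiplying [qG] on the right by [1 + h A = K (1 - h A)] clears the inverse
   hidden in [K]. *)
have key : z *: (q *m map_mx phi W) =
    q *m map_mx phi (E *m O *m (O *m E)) *m map_mx phi V.
  by rewrite -KW qG map_mxM -!scalemxAl mulmxA.
move: key; rewrite GE !map_block_mx !(map_mx0, map_mx1, map_mxZ, map_scalar_mx).
move: q_neq0; rewrite -[q]hsubmxK.
move: (lsubmx q) (rsubmx q) => a b ab_neq0.
rewrite !mul_row_block !(mulmx0, mulmx1, add0r, addr0) !mul_mx_scalar.
rewrite -!scalemxAr -!scalemxAl scale_row_mx.
case/eq_row_mx => eq1 eq2.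
have L_nsd := @Lmx_neg_semidef R d ds; rewrite -/L -/phi in L_nsd.
move: (map_mx phi L) L_nsd eq1 eq2 => LC L_nsd.
rewrite !(rmorphN, scaleNr) => eq1 eq2.
exact: (reduced_eigenvalue_lt1 h01 f01 L_nsd ab_neq0 eq1 eq2).
Qed.

Theorem proposition3p19 (R : realType)
  (T : R) (hT : 0 < T)
  (S : R) (hS : 0 < S)
  (gamma : R) (hgamma : 0 < gamma)
  (m : nat) (hm : (0 < m)%N)
  (n : nat) (hn : (2 <= n)%N)
  (ds : R) (hds0 : 0 < ds) (hds : ds = S / n%:R)
  (dt : R) (hdt0 : 0 < dt) (hdt2 : dt < 2)
  (hg : 0 < g dt (2 / ds) gamma) :
  asymptotically_stable
    ((Omx n.-1 gamma dt *m Cmx n.-1 ds dt *m Omx n.-1 gamma dt) ^+ m).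
Proof.
set M := _ *m _ *m _ => z; rewrite rmorphXn.
case/(eigenvalue_exp hm) => w Mw <-.
rewrite normrX exprn_ilt1 ?lt0n_neq0 //.
by apply: OCO_stable Mw => //; rewrite hdt0.
Qed.
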